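(* Let $f:X\to X$ be an expansive homeomorphism of a compact metric space $X$. Let $\dim_B^+X$ and $\dim_B^-X$ be the upper and lower box dimensions of $X$, and let $h(f)$ be the topological entropy of $f$. Then $$h_E^-(f)\cdot\dim_B^+X\ge h(f)\qquad\text{and}\qquad h_E^+(f)\cdot\dim_B^-X\ge h(f).$$
   Context: A homeomorphism $f$ of a compact metric space $(X,d)$ is called expansive if there is $\gamma>0$ such that, for $x,y\in X$, $d(f^k(x),f^k(y))<\gamma$ for all $k\in\mathbb{Z}$ implies $x=y$. The largest such $\gamma$ is called the expansive constant of $f$ and is denoted $\gamma(f)$. If $f$ is expansive then so is $f^n$ for every $n\in\mathbb{N}$, and one defines $$h_E^+(f)=\limsup_{n\to\infty}-\frac1n\log\gamma(f^n),\qquad h_E^-(f)=\liminf_{n\to\infty}-\frac1n\log\gamma(f^n).$$ With $N(\varepsilon)$ the smallest number of sets of diameter at most $\varepsilon$ needed to cover $X$, $\dim_B^+X$ and $\dim_B^-X$ are the limsup and liminf, respectively, of $\log N(\varepsilon)/(-\log\varepsilon)$ as $\varepsilon\to0$. The topological entropy is $h(f)=\lim_{\varepsilon\to0}\limsup_{n\to\infty}\frac1n\log s_n(\varepsilon)$, where $s_n(\varepsilon)$ is the maximal cardinality of a set of points of $X$ such that any two distinct points $x,y$ of it satisfy $\max_{0\le k\le n-1}d(f^k(x),f^k(y))\ge\varepsilon$.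
   Formalization: Each inequality is claimed only when its product of h_E and box dimension is not of the indeterminate form 0 times infinity; such cases occur (full 2-shift with suitable metrics), and with 0 times infinity read as 0 the inequality fails there. *)

(* Defs.v *)
From mathcomp Require Import all_boot all_order all_algebra finmap.
From mathcomp Require Import all_classical all_reals all_analysis.

Set Implicit Arguments.
Unset Strict Implicit.
Unset Printing Implicit Defensive.

Import Order.TTheory GRing.Theory Num.Theory.
Import numFieldNormedType.Exports.

Local Open Scope classical_set_scope.
Local Open Scope ring_scope.
Local Open Scope ereal_scope.

Record homeo (X : topologicalType) := Homeo {
  hfun :> X -> X;
  hinv : X -> X;
  hfunK : cancel hfun hinv;
  hinvK : cancel hinv hfun;
  hfun_continuous : continuous hfun;
  hinv_continuous : continuous hinv }.

Section homeo_iterates.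
Variable X : topologicalType.

Lemma iter_cancel (g h : X -> X) n :
  cancel g h -> cancel (iter n g) (iter n h).
Proof.
by move=> gK; elim: n => [//|n IHn] x; rewrite [iter n.+1 h _]iterSr iterS gK IHn.
Qed.

Lemma iter_continuous (g : X -> X) n : continuous g -> continuous (iter n g).
Proof.
move=> cg; elim: n => [|n IHn] x; first exact: cvg_id.
exact: (continuous_comp (IHn x) (cg _)).
Qed.

Definition homeo_iter (f : homeo X) (n : nat) : homeo X :=
  Homeo (iter_cancel n (@hfunK _ f)) (iter_cancel n (@hinvK _ f))
        (iter_continuous (@hfun_continuous _ f))
        (iter_continuous (@hinv_continuous _ f)).

(* [Negz n] is the integer [- n.+1]. *)
Definition ziter (f : homeo X) (k : int) : X -> X :=
  match k with
  | Posz n => iter n f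
  | Negz n => iter n.+1 (hinv f)
  end.

End homeo_iterates.

Section expansive.
Variables (R : realType) (X : metricType R).
Implicit Types (f : homeo X) (g : R).

Definition expansive_at f g : Prop :=
  forall x y : X,
    (forall k : int, (mdist (ziter f k x) (ziter f k y) < g)%R) -> x = y.

Definition expansive f : Prop := exists g, (0 < g)%R /\ expansive_at f g.

(* A supremum, as the set need not have a largest element; for compact [X]
   the value is +oo exactly when [X] has at most one point. *)
Definition expansive_constant f : \bar R :=
  ereal_sup [set g%:E | g in [set g | (0 < g)%R /\ expansive_at f g]].

Definition hE_seq f (n : nat) : \bar R :=
  (- n%:R^-1)%:E * lne (expansive_constant (homeo_iter f n)).

Definition hE_upper f : \bar R := limn_esup (hE_seq f).
Definition hE_lower f : \bar R := limn_einf (hE_seq f).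

End expansive.

Section box_dimension.
Variables (R : realType) (X : metricType R).

Definition diam_le (A : set X) (e : R) : Prop :=
  forall x y, A x -> A y -> (mdist x y <= e)%R.

Definition covering_number (e : R) : \bar R :=
  ereal_inf [set n%:R%:E | n in [set n : nat |
    exists A : 'I_n -> set X,
      (forall i, diam_le (A i) e) /\ \bigcup_i A i = [set: X]]].

Definition box_ratio (e : R) : \bar R :=
  lne (covering_number e) * ((- ln e)^-1)%:E.

Definition upper_box_dim : \bar R := limf_esup box_ratio 0^'+.
Definition lower_box_dim : \bar R := limf_einf box_ratio 0^'+.

End box_dimension.

Section entropy.
Variables (R : realType) (X : metricType R).
Implicit Types f : X -> X.

Definition bowen_dist f (n : nat) (x y : X) : R :=
  \big[Order.max/0%R]_(k < n) mdist (iter k f x) (iter k f y).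

Definition separated f (n : nat) (e : R) (S : {fset X}) : Prop :=
  forall x y, x \in S -> y \in S -> x != y -> (e <= bowen_dist f n x y)%R.

Definition separated_number f (n : nat) (e : R) : \bar R :=
  ereal_sup [set (#|` S|%:R)%:E | S in [set S : {fset X} | separated f n e S]].

Definition topological_entropy f : \bar R :=
  lim ((fun e : R =>
          limn_esup (fun n => (n%:R^-1)%:E * lne (separated_number f n e)))
       @ 0^'+).

End entropy.

(* The product of [a] and [b] is not of the form 0 * (+oo), which the library
   sets to 0. For the two-sided 2-shift with the metric a_n, n the least |k|
   at which two sequences differ, the entropy is ln 2 while
   - a_n = exp(- n^2) gives [hE_lower] = [hE_upper] = +oo and box dimension 0;
   - a_n = 1 / ln (n + 3) gives [hE_lower] = [hE_upper] = 0 and box dimension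
     +oo.
   (-oo) * 0 = 0 is allowed, so that one-point spaces are covered. *)
Definition determinate_prod (R : realType) (a b : \bar R) : Prop :=
  ~ (a = 0 /\ b = +oo) /\ ~ (a = +oo /\ b = 0).

(* Main.v *)
Require Import Defs.
From mathcomp Require Import all_boot all_order all_algebra finmap.
From mathcomp Require Import all_classical all_reals all_analysis.
From mathcomp Require Import lra zify.

(** Fix [n > 0], let [g] be an expansivity constant of [f^n], let [d < g], and
    cover [X] by [N] sets of diameter at most [d].  Two points whose
    [f^n]-orbits visit the same sets at all times coincide; by compactness, two
    points whose [f^n]-orbits visit the same sets at the times [-M, ..., M] are
    close, together with their first [n] images under [f], where [M] depends
    only on the required precision [e].  A set of points which is
    [e]-separated along [m] iterates of [f] therefore injects into the words
    of length [m / n + 2 M + 1] over an alphabet of [N] letters, and taking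
    logarithms, dividing by [m] and letting [m] go to infinity gives
    [h(f) <= log N(d) / n] ([entropy_le_covering_number]).

    It remains to choose the scale [d].  If [hE_seq f n < c], then
    [exp (- n c)] lies below some expansivity constant of [f^n], so any
    [d <= exp (- n c)] is admissible.
    - Given [a > hE_lower f] and [b > upper_box_dim X], there are
      arbitrarily large [n] with [hE_seq f n < a]; for
      large ones among them the scale [d = exp (- n a)] is so small that
      [log N(d) < b * n * a], whence [h(f) <= a * b].
    - Given [a > a' > hE_upper f] and [b > lower_box_dim X], all large [n]
      satisfy [hE_seq f n < a'], but only some arbitrarily small scales [d]
      satisfy [log N(d) < b * - log d].  For such a [d], the integer part [n]
      of [- log d / a'] gives [d <= exp (- n a')] and
      [- log d <= (n + 1) a' <= n a], whence again [h(f) <= a * b].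
    Letting [a] and [b] decrease to the two factors yields the product
    ([lee_determinate_prod], where infinite factors are settled by the
    determinacy of the product).  This uses that the factors are nonnegative,
    which holds as soon as [X] has two points: the expansivity constants [g] of
    all [f^n] are then bounded by the diameter, so that [- log g / n] has a
    nonnegative lower limit.  Spaces with at most one point are treated apart. *)

Set Implicit Arguments.
Unset Strict Implicit.
Unset Printing Implicit Defensive.

Import Order.TTheory GRing.Theory Num.Theory.
Import numFieldNormedType.Exports.

Local Open Scope classical_set_scope.
Local Open Scope ring_scope.
Local Open Scope ereal_scope.

(** * Upper and lower limits along a filter *)

Section limsup.
Variables (R : realType) (T : topologicalType).
Implicit Types (u v : T -> \bar R) (F : set_system T) (c : \bar R).

Lemma limf_esup_lt u F c : Filter F -> limf_esup u F < c ->
  \forall x \near F, u x < c.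
Proof.
move=> FF; rewrite limf_esupE => /ereal_inf_lt[_ [V FV <-] Vc].
apply: filterS FV => x Vx; apply: le_lt_trans Vc.
by apply: ereal_sup_ubound; exists x.
Qed.

Lemma limf_einf_lt u F c (V : set T) : limf_einf u F < c -> F V ->
  exists2 x, V x & u x < c.
Proof.
rewrite limf_einfE => infc FV.
have /ereal_inf_lt[_ [x Vx <-] uxc] : ereal_inf (u @` V) < c.
  by apply: le_lt_trans infc; apply: ereal_sup_ubound; exists V.
by exists x.
Qed.

Lemma le_limf_esup u v F : Filter F -> (\forall x \near F, u x <= v x) ->
  limf_esup u F <= limf_esup v F.
Proof.
move=> FF uv; rewrite !limf_esupE; apply: le_ereal_inf_tmp => _ [V FV <-].
pose W := V `&` [set x | u x <= v x].
apply: (@le_trans _ _ (ereal_sup (u @` W))).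
  by apply: ereal_inf_lbound; exists W => //; exact: filterI.
apply: ge_ereal_sup => _ [x [Vx uvx] <-]; apply: (le_trans uvx).
by apply: ereal_sup_ubound; exists x.
Qed.

Lemma limf_esup_le u F c : (\forall x \near F, u x <= c) -> limf_esup u F <= c.
Proof.
move=> uc; rewrite limf_esupE.
apply: (@le_trans _ _ (ereal_sup (u @` [set x | u x <= c]))).
  by apply: ereal_inf_lbound; exists [set x | u x <= c].
by apply: ge_ereal_sup => _ [x /= uxc <-].
Qed.

Lemma limf_einf_ge u F c : ProperFilter F -> (\forall x \near F, c <= u x) ->
  c <= limf_einf u F.
Proof.
move=> FF cu; rewrite leNgt; apply/negP => /limf_einf_lt /(_ cu)[x /= cux].
by rewrite ltNge cux.
Qed.

Lemma limf_einf_le_esup u F : ProperFilter F -> limf_einf u F <= limf_esup u F.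
Proof.
move=> FF; rewrite limf_esupE; apply: le_ereal_inf_tmp => _ [V FV <-].
rewrite leNgt; apply/negP => supV.
have [_ [W FW <-] supVW] : exists2 y, [set ereal_inf (u @` W) | W in F] y &
    ereal_sup (u @` V) < y by apply: ereal_sup_gt; rewrite -limf_einfE.
have [x [Vx Wx]] := filter_ex (filterI FV FW).
move: supVW; rewrite ltNge => /negP; apply; apply: (@le_trans _ _ (u x)).
  by apply: ereal_inf_lbound; exists x.
by apply: ereal_sup_ubound; exists x.
Qed.

End limsup.

Lemma limn_esup_addV (R : realType) (k c : R) :
  limn_esup (fun n => (k + n%:R^-1 * c)%:E) = k%:E.
Proof.
apply: (cvg_limn_einf_sup _).2; apply: cvg_EFin; first by near=> n.
rewrite -[X in _ --> X]addr0 -[X in _ --> (_ + X)%R](mul0r c).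
apply: cvgD; first exact: cvg_cst.
apply: cvgM; last exact: cvg_cst.
by rewrite -(cvg_shiftS (fun n : nat => n%:R^-1 : R)%R); exact: cvg_harmonic.
Unshelve. all: by end_near. Qed.

(** * Extended real numbers *)

Section ereal.
Variable R : realType.
Implicit Types x y h : \bar R.

Lemma le_lne x y : x <= y -> lne x <= lne y.
Proof.
have [x0 _|x0 xy] := leP x 0; first by rewrite le0_lneNy// leNye.
by rewrite lee_lne// in_itv/= leey ltW// (lt_le_trans x0).
Qed.

(** If one factor is infinite, determinacy makes the other one positive, so that
    the product is infinite and there is nothing to prove. *)
Lemma lee_determinate_prod x y h : 0 <= x -> 0 <= y -> determinate_prod x y ->
  (forall a b : R, x < a%:E -> y < b%:E -> h <= (a * b)%:E) -> h <= x * y.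
Proof.
move=> x0 y0 [xy0 xyoo] hab.
have [xoo|xoo] := eqVneq x +oo.
  rewrite xoo gt0_mulye ?leey// lt_neqAle y0 andbT eq_sym.
  by apply/eqP => y_eq0; apply: xyoo.
have [yoo|yoo] := eqVneq y +oo.
  rewrite yoo gt0_muley ?leey// lt_neqAle x0 andbT eq_sym.
  by apply/eqP => x_eq0; apply: xy0.
move: x y x0 y0 {xy0 xyoo} hab xoo yoo => [r| |] [s| |]//.
rewrite !lee_fin => r0 s0 hab _ _.
apply/lee_addgt0Pr => e e0.
have rs1 : (0 < r + s + 2)%R by lra.
(* [t <= 1] makes [(r + t) * (s + t) - r * s <= t * (r + s + 1)]. *)
pose t := Num.min 1%R (e / (r + s + 2))%R.
have t0 : (0 < t)%R by rewrite lt_min ltr01 divr_gt0.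
have t1 : (t <= 1)%R by rewrite ge_min lexx.
have te : (t * (r + s + 2) <= e)%R by rewrite -ler_pdivlMr// ge_min lexx orbT.
apply: (le_trans (hab (r + t)%R (s + t)%R _ _)); rewrite ?lte_fin ?ltrDl//.
rewrite -EFinM -EFinD lee_fin; nra.
Qed.

End ereal.

(** * Uniform expansivity on a compact metric space *)

Section metric.
Variables (R : realType) (X : metricType R).

Lemma mdist_continuous : continuous (fun p : X * X => mdist p.1 p.2).
Proof.
move=> [x y] /=; apply/cvgrPdist_lt => e e0.
have e2 : (0 < e / 2)%R by rewrite divr_gt0.
have Hb : nbhs (x, y) (ball x (e / 2)%R `*` ball y (e / 2)%R).
  by exists (ball x (e / 2), ball y (e / 2))%R => //=; split; exact: nbhsx_ballx.
near=> p.
have [] : (ball x (e / 2)%R `*` ball y (e / 2)%R) p by near: p.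
rewrite !ballEmdist /= => xp yp.
have := metric_triangle x p.1 y; have := metric_triangle p.1 p.2 y.
have := metric_triangle p.1 x p.2; have := metric_triangle x y p.2.
rewrite (metric_sym p.1 x) (metric_sym p.2 y) => *.
rewrite ltr_norml; lra.
Unshelve. all: by end_near. Qed.

Lemma mdist_comp_continuous (phi : X -> X) : continuous phi ->
  continuous (fun p : X * X => mdist (phi p.1) (phi p.2)).
Proof.
move=> phic p; apply: (@continuous_comp _ _ _
  (fun q : X * X => (phi q.1, phi q.2)) (fun q : X * X => mdist q.1 q.2) p);
  last exact: mdist_continuous.
apply: cvg_pair.
- by apply: (@continuous_comp _ _ _ fst phi p); [exact: cvg_fst|exact: phic].
- by apply: (@continuous_comp _ _ _ snd phi p); [exact: cvg_snd|exact: phic].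
Qed.

Hypothesis X_compact : compact [set: X].

Lemma compact_mdist_bounded : exists D : R, forall x y : X, (mdist x y <= D)%R.
Proof.
have XX : compact ([set: X] `*` [set: X]) by exact: compact_setX.
have /compact_bounded[M [_ /(_ (M + 1)%R)]] :=
  continuous_compact (continuous_subspaceT mdist_continuous) XX.
rewrite ltrDl => /(_ ltr01) MD; exists (M + 1)%R => x y.
by rewrite (le_trans (ler_norm _))//; apply: MD; exists (x, y).
Qed.

Lemma ziter_continuous (f : homeo X) k : continuous (ziter f k).
Proof.
case: k => n; apply: iter_continuous; first exact: hfun_continuous.
exact: hinv_continuous.
Qed.

(** Expansivity needs all times; compactness makes a finite window of times
    suffice for a given precision.  Otherwise there would be pairs
    which stay [d]-close on ever larger windows while their images under [phi]
    stay [e] apart, and a cluster point of such pairs would be a pair that is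
    [d]-close at all times, hence diagonal, with images [e] apart. *)
Lemma expansive_window (f : homeo X) (g d e : R) (phi : X -> X) :
    expansive_at f g -> (d < g)%R -> continuous phi -> (0 < e)%R ->
  exists M : nat, forall x y : X,
    (forall k : int, (`|k| <= M)%N ->
      (mdist (ziter f k x) (ziter f k y) <= d)%R) ->
    (mdist (phi x) (phi y) < e)%R.
Proof.
move=> fg dg phic e0; apply: contrapT => /forallNP noM.
have /choice[u uP] : forall M, exists p : X * X,
    (forall k : int, (`|k| <= M)%N ->
      (mdist (ziter f k p.1) (ziter f k p.2) <= d)%R) /\
    (e <= mdist (phi p.1) (phi p.2))%R.
  move=> M; have /existsNP[x /existsNP[y /not_implyP[xyM /negP]]] := noM M.
  by rewrite -leNgt => xye; exists (x, y).
have [[x y] [_ xyu]] : ([set: X] `*` [set: X]) `&` cluster (u @ \oo) !=set0.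
  have := compact_setX X_compact X_compact; apply.
  by apply: filterS filterT => n _.
have closed_lim (C : set (X * X)) :
    closed C -> (\forall n \near \oo, C (u n)) -> C (x, y).
  move=> /closure_id Ccl Cu; rewrite Ccl.
  by move: xyu; rewrite clusterE; apply.
have xy : x = y.
  apply: fg => k; apply: le_lt_trans dg.
  apply: (closed_lim [set p | (mdist (ziter f k p.1) (ziter f k p.2) <= d)%R]).
    have /continuous_closedP := mdist_comp_continuous (@ziter_continuous f k).
    by move=> /(_ _ (@closed_le _ d)).
  near=> n; apply: (uP n).1; near: n; exact: nbhs_infty_ge.
have : (e <= mdist (phi x) (phi y))%R.
  apply: (closed_lim [set p | (e <= mdist (phi p.1) (phi p.2))%R]).
    have /continuous_closedP := mdist_comp_continuous phic.
    by move=> /(_ _ (@closed_ge _ e)).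
  by near=> n; exact: (uP n).2.
by rewrite xy mdistxx leNgt e0.
Unshelve. all: by end_near. Qed.

(** Shifting the base point by [M] turns a window centred at time 0 into one of
    nonnegative times, so that only forward iterates have to be counted. *)
Lemma ziter_iter (f : homeo X) M (k : int) x : (`|k| <= M)%N ->
  ziter f k (iter M f x) = iter (absz (M%:Z + k)%R) f x.
Proof.
case: k => n nM.
  have -> : absz (M%:Z + Posz n)%R = (n + M)%N by lia.
  by rewrite iterD.
have -> : absz (M%:Z + Negz n)%R = (M - n.+1)%N by lia.
rewrite -{1}(subnKC nM) iterD -[LHS]/(iter n.+1 (hinv f) _).
exact: iter_cancel (@hfunK _ f) _.
Qed.

(** Between two consecutive iterates of [f^n] the orbit of [f] takes [n] steps,
    which have to be controlled as well; the window is the largest of those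
    obtained for the maps [f^j], [j < n]. *)
Lemma expansive_orbit_window (f : homeo X) n (g d e : R) :
    expansive_at (homeo_iter f n) g -> (d < g)%R -> (0 < e)%R ->
  exists M : nat, forall x y : X,
    (forall k, (k <= 2 * M)%N ->
      (mdist (iter (k * n) f x) (iter (k * n) f y) <= d)%R) ->
    forall j, (j < n)%N ->
      (mdist (iter (j + M * n) f x) (iter (j + M * n) f y) < e)%R.
Proof.
move=> fg dg e0.
have /choice[M MP] (j : nat) := expansive_window fg dg
  (@iter_continuous _ f j (@hfun_continuous _ f)) e0.
exists (\max_(j < n) M j)%N => x y xyd j jn.
rewrite !iterD !iterM; apply: (MP j) => k kM.
have {}kM : (`|k| <= \max_(j < n) M j)%N.
  exact: leq_trans kM (leq_bigmax (Ordinal jn)).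
rewrite !(ziter_iter (homeo_iter f n))//.
rewrite -!iterM; apply: xyd; lia.
Qed.

End metric.

(** * Entropy and coverings *)

Section entropy.
Variables (R : realType) (X : metricType R).
Hypothesis X_compact : compact [set: X].
Variable f : homeo X.

(** The function [idx] labels each point by a member of the cover containing
    it.  Two points with the same labels at the times [k n], [k] between [- M]
    and [m / n + M], are [e]-close along [m] iterates of [f], so distinct points
    of a separated set have distinct itineraries. *)
Lemma separated_card_le n (g d e : R) N (idx : X -> 'I_N) :
    (0 < n)%N -> expansive_at (homeo_iter f n) g -> (d < g)%R -> (0 < e)%R ->
    (forall x y, idx x = idx y -> (mdist x y <= d)%R) ->
  exists M, forall m S, Defs.separated f m e S ->
    (#|` S| <= N ^ (m %/ n + (2 * M).+1))%N.
Proof.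
move=> n0 fg dg e0 idxd.
have [M MP] := expansive_orbit_window X_compact fg dg e0.
exists M => m S sepS; set K := (m %/ n + (2 * M).+1)%N.
(* Starting the itinerary at [f^(- M n) x] makes all its times nonnegative. *)
pose z := iter (M * n) (hinv f).
pose code (x : S) := [ffun k : 'I_K => idx (iter (k * n) f (z (val x)))].
have zK x : iter (M * n) f (z x) = x by exact: (iter_cancel _ (@hinvK _ f)).
suff /leq_card : injective code by rewrite card_ffun !card_ord -cardfE.
move=> x y xy; apply/val_inj/eqP/negPn/negP => neq_xy.
have := sepS _ _ (valP x) (valP y) neq_xy.
rewrite leNgt => /negP; apply; apply: bigmax_lt => // i _.
have iE u : iter i f u = iter (i %% n + M * n) f (iter (i %/ n * n) f (z u)).
  rewrite -[in LHS](zK u) -!iterD; congr (iter _ _ _).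
  by rewrite [in LHS](divn_eq i n); lia.
rewrite !iE; apply: MP (ltn_pmod _ n0) => k kM.
rewrite -!iterD -!mulnDl; apply: idxd.
have ltK : (k + i %/ n < K)%N.
  by rewrite /K; have := leq_div2r n (ltnW (ltn_ord i)); lia.
by have /ffunP/(_ (Ordinal ltK)) := xy; rewrite !ffunE.
Qed.

(** The [2 M + 1] extra letters contribute a term of order [1 / m], which
    disappears in the limit. *)
Lemma entropy_rate_le n (g d e : R) N (idx : X -> 'I_N) :
    (0 < n)%N -> (0 < N)%N -> expansive_at (homeo_iter f n) g -> (d < g)%R ->
    (0 < e)%R ->
    (forall x y, idx x = idx y -> (mdist x y <= d)%R) ->
  limn_esup (fun m => (m%:R^-1)%:E * lne (separated_number f m e))
    <= (n%:R^-1 * ln N%:R)%:E.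
Proof.
move=> n0 N0 fg dg e0 idxd.
have [M MP] := separated_card_le n0 fg dg e0 idxd.
have nR : (0 < n%:R :> R)%R by rewrite ltr0n.
have lnN : (0 <= ln N%:R :> R)%R by rewrite ln_ge0// ler1n.
pose C : R := ((2 * M).+1%:R * ln N%:R)%R.
rewrite -(limn_esup_addV _ C); apply: le_limf_esup; near=> m.
have m0 : (0 < m)%N by near: m; exact: nbhs_infty_gt.
have mR : (0 < m%:R :> R)%R by rewrite ltr0n.
rewrite lee_pdivrMl//.
have : separated_number f m e <= (N ^ (m %/ n + (2 * M).+1))%:R%:E.
  by apply: ge_ereal_sup => _ [S sepS <-]; rewrite lee_fin ler_nat MP.
move=> /le_lne /le_trans; apply.
rewrite natrX lne_EFin ?exprn_gt0 ?ltr0n// lnXn ?ltr0n// -EFinM lee_fin.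
rewrite mulrDr mulVKf ?gt_eqF// -[leLHS]mulr_natl natrD mulrDl lerD2r.
rewrite mulrA ler_wpM2r//.
rewrite ler_pdivlMr// -natrM ler_nat; exact: leq_trunc_div.
Unshelve. all: by end_near. Qed.

(** The rate of separation increases as the scale [e] decreases, so the limit
    defining the entropy exists; without this [lim] would have no meaning. *)
Lemma entropy_le (c : \bar R) :
    (forall e : R, (0 < e)%R ->
      limn_esup (fun m => (m%:R^-1)%:E * lne (separated_number f m e)) <= c) ->
  topological_entropy f <= c.
Proof.
move=> ec; apply: lime_le.
  apply: nonincreasing_at_right_is_cvge; near=> a => e e' _ _ ee'.
  apply: le_limf_esup; near=> m; apply: lee_wpmul2l => //.
  apply/le_lne/ereal_sup_le => _ [S sepS <-]; exists S => // x y xS yS xy.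
  exact: le_trans ee' (sepS x y xS yS xy).
near=> e; apply: ec; near: e; exact: nbhs_right_gt.
Unshelve. all: by end_near. Qed.

Lemma entropy_le_covering_number n (g d : R) (x0 : X) :
    (0 < n)%N -> expansive_at (homeo_iter f n) g -> (d < g)%R ->
  topological_entropy f <= (n%:R^-1)%:E * lne (covering_number X d).
Proof.
move=> n0 fg dg; have nR : (0 < n%:R :> R)%R by rewrite ltr0n.
rewrite lee_pdivlMl// -[leLHS]expeRK; apply: le_lne.
apply: le_ereal_inf_tmp => _ [N [A [Ad Acover]] <-].
have /choice[idx idxA] (x : X) : exists i, A i x.
  by have : [set: X] x by []; rewrite -Acover => -[i _]; exists i.
have N0 : (0 < N)%N by exact: leq_ltn_trans (ltn_ord (idx x0)).
have NR : (0 < N%:R :> R)%R by rewrite ltr0n.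
have -> : N%:R%:E = expeR (ln N%:R)%:E :> \bar R by rewrite /= lnK.
rewrite lee_expeR -lee_pdivlMl// -EFinM.
apply: entropy_le => e e0; apply: (entropy_rate_le n0 N0 fg dg e0 (idx := idx)).
by move=> x y xy; apply: (Ad (idx x)) => //; rewrite xy.
Qed.

End entropy.

(** * Choice of the scale *)

Section growth_rates.
Variables (R : realType) (X : metricType R).
Hypothesis X_compact : compact [set: X].
Variable f : homeo X.

Lemma hE_seq_lt_expansive n (c : R) : (0 < n)%N -> hE_seq f n < c%:E ->
  exists2 g, expansive_at (homeo_iter f n) g & (expR (- (n%:R * c)) < g)%R.
Proof.
move=> n0; have nR : (0 < n%:R :> R)%R by rewrite ltr0n.
rewrite /hE_seq EFinN mulNe lteNl -EFinN lte_pdivlMl// -EFinM mulrN => hc.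
have /ereal_sup_gt[_ [g [_ fg] <-]] :
    (expR (- (n%:R * c)))%:E < expansive_constant (homeo_iter f n).
  rewrite ltNge; apply: contraTN hc => /le_lne.
  by rewrite lne_EFin ?expR_gt0// expRK leNgt.
by rewrite lte_fin => cg; exists g.
Qed.

(** The number [c] only serves to guarantee that [e] is a scale below an
    expansivity constant of [f^n]; the bound itself is that of
    [entropy_le_covering_number], with [log N(e) < b * - log e]. *)
Lemma entropy_le_box_ratio n (b c e : R) (x0 : X) :
    (0 < n)%N -> hE_seq f n < c%:E -> (0 < e < 1)%R ->
    (e <= expR (- (n%:R * c)))%R -> box_ratio X e < b%:E ->
  topological_entropy f <= (b * - ln e / n%:R)%:E.
Proof.
move=> n0 fc /andP[e0 e1] ec.
have nR : (0 < n%:R :> R)%R by rewrite ltr0n.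
have lne0 : (0 < - ln e)%R by rewrite oppr_gt0 ln_lt0// e0.
rewrite /box_ratio lte_pdivrMr// -EFinM => /ltW Neb.
have [g fg cg] := hE_seq_lt_expansive n0 fc.
have := entropy_le_covering_number X_compact x0 n0 fg (le_lt_trans ec cg).
move=> /le_trans; apply.
by rewrite lee_pdivrMl// -EFinM mulrC divfK// gt_eqF.
Qed.

Lemma box_ratio_ge0 (x0 : X) : \forall e \near 0^'+, 0 <= box_ratio X e.
Proof.
near=> e; apply: mule_ge0.
  rewrite lne_ge0; apply: le_ereal_inf_tmp => _ [N [A [_ Acover]] <-].
  have : [set: X] x0 by []; rewrite -Acover => -[i _ _].
  by rewrite lee_fin ler1n (leq_ltn_trans _ (ltn_ord i)).
rewrite lee_fin invr_ge0 oppr_ge0 ln_le0//; near: e; exact: nbhs_right_le.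
Unshelve. all: by end_near. Qed.

Lemma box_dim_ge0 (x0 : X) : 0 <= lower_box_dim X <= upper_box_dim X.
Proof.
by rewrite limf_einf_ge ?limf_einf_le_esup//; exact: box_ratio_ge0.
Qed.

(** With two distinct points, no expansivity constant of any [f^n] exceeds the
    diameter [D], hence [hE_seq f n >= - (log D) / n]. *)
Lemma hE_ge0 (x y : X) : x <> y -> 0 <= hE_lower f <= hE_upper f.
Proof.
move=> neq_xy; rewrite limn_einf_sup andbT oppe_ge0.
have [D XD] := compact_mdist_bounded X_compact.
have D0 : (0 < D)%R by rewrite (lt_le_trans _ (XD x y))// mdist_gt0; apply/eqP.
rewrite -[leRHS](limn_esup_addV 0 (ln D)); apply: le_limf_esup; near=> n.
rewrite /hE_seq EFinN mulNe oppeK add0r EFinM; apply: lee_wpmul2l => //.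
rewrite -(lne_EFin D0); apply/le_lne/ge_ereal_sup => _ [g [_ fg] <-].
rewrite lee_fin leNgt; apply/negP => Dg; apply/neq_xy/fg => k.
exact: le_lt_trans (XD _ _) Dg.
Unshelve. all: by end_near. Qed.

Lemma covering_number_subsingleton (e : R) : (forall x y : X, x = y) ->
  (0 <= e)%R -> covering_number X e <= 1.
Proof.
move=> X1 e0; apply: ereal_inf_lbound; exists 1%N => //.
exists (fun=> [set: X]); split => [_ x y _ _|]; first by rewrite (X1 x y) mdistxx.
by apply/seteqP; split => // x _; exists ord0.
Qed.

Lemma box_dim_subsingleton (x0 : X) : (forall x y : X, x = y) ->
  lower_box_dim X = 0 /\ upper_box_dim X = 0.
Proof.
move=> X1; have /andP[low0 low_up] := box_dim_ge0 x0.
have up0 : upper_box_dim X <= 0.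
  apply: limf_esup_le; near=> e; apply: mule_le0_ge0.
    by rewrite lne_le0 covering_number_subsingleton.
  rewrite lee_fin invr_ge0 oppr_ge0 ln_le0//; near: e; exact: nbhs_right_le.
by split; apply/eqP; rewrite eq_le ?low0 ?up0 ?(le_trans low_up)// (le_trans low0).
Unshelve. all: by end_near. Qed.

(** With a single set covering [X] there is only one itinerary. *)
Lemma entropy_subsingleton (x0 : X) : (forall x y : X, x = y) ->
  topological_entropy f <= 0.
Proof.
move=> X1; have f1 : expansive_at (homeo_iter f 1) 1%R by move=> x y _; exact: X1.
have := entropy_le_covering_number X_compact x0 (ltn0Sn 0) f1 ltr01.
move=> /le_trans; apply.
by rewrite invr1 mul1e lne_le0 covering_number_subsingleton.
Qed.

Lemma entropy_empty : ~ (exists x : X, True) -> topological_entropy f = -oo.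
Proof.
move=> X0; apply/eqP; rewrite -leeNy_eq; apply: entropy_le => e e0.
apply: limf_esup_le; near=> m.
have mR : (0 < m%:R :> R)%R by rewrite ltr0n; near: m; exact: nbhs_infty_gt.
rewrite le0_lneNy ?gt0_muleNy ?lte_fin ?invr_gt0//.
apply: ge_ereal_sup => _ [S _ <-].
have [->|[x _]] := fset_0Vmem S; first by rewrite cardfs0.
by exfalso; apply: X0; exists x.
Unshelve. all: by end_near. Qed.

(** A good [n] is available infinitely often, and every small scale is good. *)
Lemma entropy_le_hE_lower (x0 : X) (a b : R) : (0 < a)%R ->
    hE_lower f < a%:E -> upper_box_dim X < b%:E ->
  topological_entropy f <= (a * b)%:E.
Proof.
move=> a0 fa Xb.
have [r r0 rb] : \forall e \near 0^'+, box_ratio X e < b%:E /\ (e < 1)%R.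
  exact: filterI (limf_esup_lt _ Xb) (nbhs_right_lt ltr01).
(* The last condition says that [expR (- (n * a)) < r]. *)
pose V n := (0 < n)%N /\ (- ln r / a < n%:R)%R.
have Voo : \oo V by apply: filterI; [exact: nbhs_infty_gt|exact: nbhs_infty_gtr].
have [n [n0 rn] fna] := limf_einf_lt fa Voo.
have nR : (0 < n%:R :> R)%R by rewrite ltr0n.
have [] := rb (expR (- (n%:R * a))%R); rewrite /= ?expR_gt0//.
  rewrite sub0r normrN gtr0_norm ?expR_gt0// -[ltRHS]lnK// ltr_expR ltrNl.
  by rewrite -ltr_pdivrMr.
move=> /(entropy_le_box_ratio x0 n0 fna) + e1; rewrite expR_gt0 e1 lexx expRK.
move=> /(_ isT isT) /le_trans; apply.
by rewrite opprK mulrCA mulrAC divff ?mul1r 1?mulrC// gt_eqF.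
Qed.

(** Every large [n] is good, but good scales are only available infinitely often,
    so the scale is chosen first; the gap between [a'] and [a] absorbs the
    rounding of [n] to an integer. *)
Lemma entropy_le_hE_upper (x0 : X) (a b : R) : (0 <= b)%R -> 0 <= hE_upper f ->
    hE_upper f < a%:E -> lower_box_dim X < b%:E ->
  topological_entropy f <= (a * b)%:E.
Proof.
move=> b0 f0 fa Xb.
have [a' a'0 [fa' a'a]] : exists2 a' : R,
    (0 < a')%R & hE_upper f < a'%:E /\ (a' < a)%R.
  move: f0 fa; case: (hE_upper f) => [r| |]//; rewrite lee_fin lte_fin => r0 ra.
  by exists ((r + a) / 2)%R; [lra|rewrite lte_fin; split; lra].
(* The last condition says that [(n + 1) * a' < n * a]. *)
have [N _ NP] : \forall n \near \oo,
    [/\ (0 < n)%N, hE_seq f n < a'%:E & (a' / (a - a') < n%:R)%R].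
  near=> n; split; near: n.
  - exact: nbhs_infty_gt.
  - exact: limf_esup_lt fa'.
  - exact: nbhs_infty_gtr.
pose V (e : R) := [/\ (0 < e)%R, (e < 1)%R & (e <= expR (- (N%:R * a')))%R].
have V0 : 0^'+ V.
  near=> e; split; near: e; [exact: nbhs_right_gt|exact: nbhs_right_lt|].
  by apply: nbhs_right_le; rewrite expR_gt0.
have [e [e0 e1 eN] eb] := limf_einf_lt Xb V0.
pose q := (- ln e / a')%R; pose n := Num.truncn q.
have q0 : (0 <= q)%R by rewrite divr_ge0 ?(ltW a'0)// oppr_ge0 ln_le0// ltW.
have /andP[nq qn] := truncn_itv q0.
have Nn : (N <= n)%N.
  rewrite truncn_ge_nat// ler_pdivlMr// lerNr.
  by rewrite -ler_expR lnK.
have [n0 fn na] := NP n Nn.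
have nR : (0 < n%:R :> R)%R by rewrite ltr0n.
apply: le_trans (entropy_le_box_ratio x0 n0 fn _ _ eb) _; first by rewrite e0.
  by rewrite -[leLHS]lnK// ler_expR lerNr -ler_pdivlMr.
rewrite lee_fin -mulrA mulrC ler_wpM2r// ler_pdivrMr//.
move: qn; rewrite ltr_pdivrMr// => /ltW/le_trans; apply.
by move: na; rewrite ltr_pdivrMr ?subr_gt0// -natr1; nra.
Unshelve. all: by end_near. Qed.

End growth_rates.

Theorem theorem4p1 (R : realType) (X : metricType R) (f : homeo X)
    (X_compact : compact [set: X]%classic) (f_expansive : expansive f) :
  (determinate_prod (hE_lower f) (upper_box_dim X) ->
     (hE_lower f * upper_box_dim X >= topological_entropy f)%E) /\
  (determinate_prod (hE_upper f) (lower_box_dim X) ->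
     (hE_upper f * lower_box_dim X >= topological_entropy f)%E).
Proof.
have [[x0 _]|/(entropy_empty f) ->] := pselect (exists x : X, True); last first.
  by split => _; exact: leNye.
have [X1|/existsNP[x /existsNP[y neq_xy]]] := pselect (forall x y : X, x = y).
  have [-> ->] := box_dim_subsingleton x0 X1.
  by rewrite !mule0; split => _; exact: entropy_subsingleton.
have /andP[low0 low_up] := box_dim_ge0 x0.
have up0 := le_trans low0 low_up.
have /andP[hlow0 hlow_up] := hE_ge0 X_compact f neq_xy.
have hup0 := le_trans hlow0 hlow_up.
split => det; apply: lee_determinate_prod => // a b fa Xb.
- apply: entropy_le_hE_lower => //.
  by rewrite -lte_fin (le_lt_trans hlow0).
- apply: entropy_le_hE_upper => //.
  by rewrite -lee_fin (le_trans low0)// ltW.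
Qed.
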